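(* Let $\mathbf{x}=[q\;\;p]^\top$ and $\mathbf{f},\mathbf{g}\in\mathcal{P}_{q,p}^{2\times1}$, and consider the QSDEs $$d\mathbf{x}(t)=\mathbf{f}(\mathbf{x}(t))\,dt+\mathbf{g}(\mathbf{x}(t))\,dA(t)^\ast+\mathbf{g}(\mathbf{x}(t))^\ast\,dA(t).$$ If these QSDEs are physically realizable, then they preserve the commutation relations, i.e. $d[\mathbf{x},\mathbf{x}^\top]=\mathbf{0}_{2\times2}$.
   Context: Let $q,p$ be self-adjoint operators (position and momentum of a single mode, $\hbar=1$) with $[q,p]=qp-pq=i1$. $\mathcal{P}_{q,p}$ is the class of functions that can be written as a power series $\sum_{j=1}^\infty a_jq^{k_j}p^{l_j}$, $a_j\in\mathbb{C}$, $k_j,l_j\in\mathbb{N}=\{0,1,\dots\}$. Series are handled formally: an element is determined by its coefficients in $q$-$p$ order, linear operations act term by term, and products and adjoints (reordered with $[q,p]=i1$) that occur are understood to be well-defined elements of $\mathcal{P}_{q,p}$. $\mathcal{O}_{q,p}=\{X\in\mathcal{P}_{q,p}:X=X^\ast\}$. $\mathcal{P}_{q,p}^{k\times l}$ denotes $k\times l$ matrices over $\mathcal{P}_{q,p}$. For vectors of operators, $[\mathbf{x},\mathbf{y}^\top]=\mathbf{x}\mathbf{y}^\top-(\mathbf{y}\mathbf{x}^\top)^\top$, the matrix with entries $[x_i,y_j]$; $^\ast$ is the entrywise adjoint; $[\mathbf{x},Y]=[[q,Y]\;\;[p,Y]]^\top$ for a single operator $Y$. Physically realizable: the QSDE is physically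 realizable if there exist $\mathbb{H}\in\mathcal{O}_{q,p}$ and $\mathbb{L}\in\mathcal{P}_{q,p}$ such that $\mathbf{f}(\mathbf{x})=-i[\mathbf{x},\mathbb{H}]+\frac12\left[(\mathbf{g}(\mathbf{x})^\ast\mathbb{L})^\ast+\mathbf{g}(\mathbf{x})^\ast\mathbb{L}\right]$ and $\mathbf{g}(\mathbf{x})=[\mathbf{x},\mathbb{L}]$. Preservation of the commutation relations: $d[\mathbf{x},\mathbf{x}^\top]=\mathbf{0}_{2\times2}$, where the differential is computed by the quantum Itô rule: $d(XY)=(dX)Y+X(dY)+(dX)(dY)$, the increments $dA,dA^\ast$ of the annihilation and creation processes commute with system operators at time $t$, and the only nonzero product of increments is $dA\,dA^\ast=dt$ (while $dA^\ast dA=dA\,dA=dA^\ast dA^\ast=0$ and all products involving $dt$ vanish). The condition means that the resulting coefficients of $dt$, $dA$ and $dA^\ast$ in each entry are zero. *)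

(* Defs.v *)
From HB Require Import structures.
From mathcomp Require Import all_boot all_order all_algebra.
From mathcomp Require Import finmap complex reals.

Set Implicit Arguments.
Unset Strict Implicit.
Unset Printing Implicit Defensive.

Import GRing.Theory Num.Theory.
Local Open Scope ring_scope.
Local Open Scope complex_scope.

(* Letters: false stands for q and true for p.  A word is the operator product
   of its letters, read from left to right. *)
Definition word := seq bool.
Definition lq : bool := false.
Definition lp : bool := true.

Section Operators.
Variable R : realType.
Let C := R[i].

(* Elements of P_{q,p}: X k l is the coefficient of q^k p^l. *)
Definition qpseries := nat -> nat -> C.

(* Operator expressions before reordering: w |-> coefficient of the word w.
   A word has finitely many factorizations, so products and adjoints are total
   here; the summability condition enters only when words are brought to q-p
   order.  Nested expressions such as (g^* L)^* are reordered as a whole, not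
   after each operation: for infinite series, iterated reordering need not
   respect X^** = X or (X Y)^* = Y^* X^*. *)
Definition wseries := word -> C.

Definition letter (a : bool) : wseries := fun w => (w == [:: a])%:R.
Definition embed (X : qpseries) : wseries := fun w =>
  let k := count_mem lq w in let l := count_mem lp w in
  if w == nseq k lq ++ nseq l lp then X k l else 0.

Definition wzero : wseries := fun=> 0.
Definition wadd (F G : wseries) : wseries := fun w => F w + G w.
Definition wsub (F G : wseries) : wseries := fun w => F w - G w.
Definition wscale (c : C) (F : wseries) : wseries := fun w => c * F w.
Definition wmul (F G : wseries) : wseries := fun w =>
  \sum_(j < (size w).+1) F (take j w) * G (drop j w).
(* q and p are self-adjoint, so the adjoint of a word is its reversal. *)
Definition wadj (F : wseries) : wseries := fun w => (F (rev w))^*.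
Definition wcomm (F G : wseries) : wseries := wsub (wmul F G) (wmul G F).

Definition qp_one : qpseries := fun s t => ((s == 0) && (t == 0))%:R.
Definition qp_zero : qpseries := fun _ _ => 0.
Definition lmulq (X : qpseries) : qpseries := fun s t =>
  if s is s'.+1 then X s' t else 0.
(* p q^s p^t = q^s p^(t+1) - i s q^(s-1) p^t, by [q, p] = i. *)
Definition lmulp (X : qpseries) : qpseries := fun s t =>
  (if t is t'.+1 then X s t' else 0) - 'i * s.+1%:R * X s.+1 t.

(* The q-p ordered form of a word, a finite sum of monomials. *)
Definition reorder (w : word) : qpseries :=
  foldr (fun a X => if a == lp then lmulp X else lmulq X) qp_one w.

(* Unconditional convergence; it covers families with finite support. *)
Definition has_sum (I : choiceType) (F : I -> C) (v : C) : Prop :=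
  forall e : R, 0 < e -> exists A : {fset I},
    forall B : {fset I}, (A `<=` B)%fset ->
      `| \sum_(i <- B) F i - v | < e%:C.

(* F, brought to q-p order with [q, p] = i, is the element X of P_{q,p}. *)
Definition denotes (F : wseries) (X : qpseries) : Prop :=
  forall s t, has_sum (fun w => F w * reorder w s t) (X s t).
Definition well_defined (F : wseries) : Prop := exists X, denotes F X.

Definition observable (H : qpseries) : Prop := denotes (wadj (embed H)) H.

Definition xvec : 'cV[wseries]_2 :=
  \col_i (if i == ord0 then letter lq else letter lp).

Definition gstarL (g : 'cV[qpseries]_2) (L : qpseries) (i : 'I_2) : wseries :=
  wmul (wadj (embed (g i 0))) (embed L).

Definition physically_realizable (f g : 'cV[qpseries]_2) : Prop :=
  exists H L : qpseries,
    [/\ observable H,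
        forall i, well_defined (gstarL g L i)
                  /\ well_defined (wadj (gstarL g L i)),
        forall i, denotes
          (wadd (wscale (- 'i) (wcomm (xvec i 0) (embed H)))
                (wscale (2%:R^-1)
                        (wadd (wadj (gstarL g L i)) (gstarL g L i))))
          (f i 0)
      & forall i, denotes (wcomm (xvec i 0) (embed L)) (g i 0)].

(* dA and dAs are the increments of the annihilation and creation processes. *)
Inductive increment := dt | dA | dAs.
Definition differential := increment -> wseries.

(* The increments commute with the system operators at time t, so only the
   order of the system coefficients matters; dA dAs = dt is the only nonzero
   product of increments. *)
Definition ito_product (dX dY : differential) : differential := fun c =>
  match c with
  | dt => wmul (dX dA) (dY dAs)
  | dA | dAs => wzero
  end.

Definition d_mul (X : wseries) (dX : differential)
    (Y : wseries) (dY : differential) : differential := fun c =>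
  wadd (wadd (wmul (dX c) Y) (wmul X (dY c))) (ito_product dX dY c).

Definition d_comm (X : wseries) (dX : differential)
    (Y : wseries) (dY : differential) : differential := fun c =>
  wsub (d_mul X dX Y dY c) (d_mul Y dY X dX c).

(* dx = f(x) dt + g(x) dAs + g(x)^* dA. *)
Definition dxvec (f g : 'cV[qpseries]_2) (i : 'I_2) : differential := fun c =>
  match c with
  | dt => embed (f i 0)
  | dA => wadj (embed (g i 0))
  | dAs => embed (g i 0)
  end.

(* The (i, j) entry of [x, x^T] = x x^T - (x x^T)^T is [x_i, x_j]. *)
Definition preserves_commutation_relations (f g : 'cV[qpseries]_2) : Prop :=
  forall (i j : 'I_2) (c : increment),
    denotes (d_comm (xvec i 0) (dxvec f g i) (xvec j 0) (dxvec f g j) c)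
            qp_zero.

End Operators.

(* Main.v *)
(* Words can be differentiated letter by letter: wder b, deleting one letter b
   in all possible ways, is a derivation of the free algebra which reordering
   turns into a partial derivative.  Reordering commutes with it even for
   infinite series, since all contributions to the coefficient of q^s p^t from
   one word have the same phase, so no cancellation occurs in the double sum.
   Hence [q, F] and i (d/dp) F denote the same element whenever F denotes one,
   and likewise [p, F] and -i (d/dq) F.  With commutators replaced by these
   derivations, the dt, dA and dAs coefficients of d[x_i, x_j] vanish before
   reordering, by the Leibniz rule and g = [x, L], up to the Hamiltonian part
   [x_j, [x_i, H]] - [x_i, [x_j, H]], which the Jacobi identity cancels after
   reordering. *)
Require Import Defs.
From mathcomp Require Import all_boot all_order all_algebra.
From mathcomp Require Import finmap boolp complex reals ring.

Set Implicit Arguments.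
Unset Strict Implicit.
Unset Printing Implicit Defensive.

Import Order.TTheory GRing.Theory Num.Theory.
Local Open Scope ring_scope.
Local Open Scope complex_scope.

(** * Sums over lists with multiplicities *)

Lemma big_uniq_cond (V : nmodType) (I : eqType) (s t : seq I) (P Q : pred I)
    (F : I -> V) :
  uniq s -> uniq t -> (forall i, (i \in s) && P i = (i \in t) && Q i) ->
  \sum_(i <- s | P i) F i = \sum_(i <- t | Q i) F i.
Proof.
move=> us ut E; rewrite -[LHS]big_filter -[RHS]big_filter.
apply/perm_big/uniq_perm; rewrite ?filter_uniq // => i.
by rewrite !mem_filter andbC E andbC.
Qed.

Lemma sumr_count_mem (V : nmodType) (I : eqType) (M s : seq I) (F : I -> V) :
  uniq M -> {subset s <= M} ->
  \sum_(i <- s) F i = \sum_(i <- M) F i *+ count_mem i s.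
Proof.
move=> uM; elim: s => [|x s IH] sM.
  by rewrite big_nil big1.
rewrite big_cons IH; last by move=> y ys; apply: sM; rewrite inE ys orbT.
have xM : x \in M by apply: sM; rewrite inE eqxx.
rewrite [RHS](eq_bigr (fun i => F i *+ (x == i) + F i *+ count_mem i s)).
  rewrite big_split /=; congr (_ + _).
  rewrite (bigD1_seq x) //= eqxx mulr1n big1 ?addr0 // => i /negbTE.
  by rewrite eq_sym => ->.
by move=> i _ /=; rewrite mulrnDr.
Qed.

(** * Norm bounds from partial sums *)

Section NormSums.
Variables (K : numClosedFieldType) (I : Type) (s : seq I).

Lemma sum_norm_real (F : I -> K) (e : K) :
  (forall i, F i \is Num.real) ->
  (forall P : pred I, `|\sum_(i <- s | P i) F i| <= e) ->
  \sum_(i <- s) `|F i| <= e *+ 2.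
Proof.
move=> Fr H; rewrite (bigID (fun i => 0 <= F i)) /=.
rewrite (eq_bigr F); last by move=> i /ger0_norm.
rewrite [X in _ + X](eq_bigr (fun i => - F i)); last first.
  by move=> i; rewrite -real_ltNge // => /ltr0_norm.
rewrite sumrN; set a := \sum_(_ <- _ | _) _; set b := \sum_(_ <- _ | _) _.
have ra : a \is Num.real by apply: rpred_sum.
have rb : b \is Num.real by apply: rpred_sum.
rewrite mulr2n lerD //; apply: le_trans (real_ler_norm _) _; rewrite ?rpredN //.
  exact: H.
by rewrite normrN; exact: H.
Qed.

(** Real and imaginary parts are the real parts of [F] and, up to sign, of ['i * F]; the real case
    bounds each by [e *+ 2]. *)
Lemma sum_norm_le (F : I -> K) (e : K) :
  (forall P : pred I, `|\sum_(i <- s | P i) F i| <= e) ->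
  \sum_(i <- s) `|F i| <= e *+ 4.
Proof.
move=> H.
have HRe (c : K) : `|c| = 1 -> \sum_(i <- s) `|'Re (c * F i)| <= e *+ 2.
  move=> c1; apply: sum_norm_real => [i|P]; first exact: Creal_Re.
  rewrite -raddf_sum -mulr_sumr; apply: le_trans _ (H P).
  rewrite -[leRHS]mul1r -c1 -normrM.
  exact: leif_normC_Re_Creal.
rewrite -[4%N]/(2 + 2)%N mulrnDr.
apply: le_trans _ (lerD (HRe 1 (normr1 _)) (HRe 'i%R (normCi _))).
rewrite -big_split /=; apply: ler_sum => i _.
rewrite {1}[F i]Crect; apply: le_trans (ler_normD _ _) _.
rewrite mul1r normrM normCi mul1r lerD2l.
by rewrite ReMil normrN.
Qed.
End NormSums.

(** * Unconditional sums *)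

Section HasSum.
Variable R : realType.
Implicit Types I J : choiceType.

Lemma has_sum_eq I (F G : I -> R[i]) v : F =1 G -> has_sum F v -> has_sum G v.
Proof. by move=> /funext ->. Qed.

Lemma has_sum_single I (F : I -> R[i]) i0 :
  (forall i, i != i0 -> F i = 0) -> has_sum F (F i0).
Proof.
move=> F0 e e0; exists [fset i0]%fset => B; rewrite fsub1set => iB.
rewrite (bigD1_seq i0) ?fset_uniq //= big1 // addr0 subrr normr0.
by rewrite (ltcR 0).
Qed.

Lemma has_sum0 I : has_sum (fun _ : I => 0 : R[i]) 0.
Proof.
by move=> e e0; exists fset0 => B _; rewrite big1 // subrr normr0 (ltcR 0).
Qed.

Lemma has_sumD I (F G : I -> R[i]) u v :
  has_sum F u -> has_sum G v -> has_sum (fun i => F i + G i) (u + v).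
Proof.
move=> HF HG e e0; have e2 : 0 < e / 2 by rewrite divr_gt0.
have [A HA] := HF _ e2; have [A' HA'] := HG _ e2.
exists (A `|` A')%fset => B; rewrite fsubUset => /andP[AB A'B].
rewrite big_split /= opprD addrACA [e]splitr rmorphD.
apply: le_lt_trans (ler_normD _ _) _; exact: ltrD (HA _ AB) (HA' _ A'B).
Qed.

Lemma has_sumZ I (c : R[i]) (F : I -> R[i]) v :
  has_sum F v -> has_sum (fun i => c * F i) (c * v).
Proof.
have [->|c0] := eqVneq c 0.
  rewrite mul0r => _; apply: has_sum_eq (has_sum0 _) => i; by rewrite mul0r.
move=> HF e e0.
have cE : `|c| = (complex.Re `|c|)%:C.
  by rewrite normc_def.
have cp : 0 < complex.Re `|c|.
  by rewrite -(ltcR 0) -cE normr_gt0.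
have [A HA] := HF _ (divr_gt0 e0 cp); exists A => B /HA H.
rewrite -mulr_sumr -mulrBr normrM cE mulrC -ltr_pdivlMr ?(ltcR 0) //.
by rewrite -fmorphV -rmorphM.
Qed.

Lemma has_sumB I (F G : I -> R[i]) u v :
  has_sum F u -> has_sum G v -> has_sum (fun i => F i - G i) (u - v).
Proof.
move=> HF /(has_sumZ (-1)) HG; rewrite -mulN1r.
by apply: has_sum_eq (has_sumD HF HG) => i; rewrite mulN1r.
Qed.

Lemma has_sum_unique I (F : I -> R[i]) u v :
  has_sum F u -> has_sum F v -> u = v.
Proof.
move=> Hu Hv; apply/eqP; rewrite -subr_eq0 -normr_eq0; apply/eqP.
have := has_sumB Hu Hv => H; have {}H e : 0 < e -> `|u - v| < e%:C.
  move=> /H[A /(_ A (fsubset_refl _))].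
  by rewrite big1 ?sub0r ?normrN // => i _; rewrite subrr.
move: H; rewrite normc_def => H.
set r := Num.sqrt _ in H *; have : 0 <= r by exact: sqrtr_ge0.
rewrite le_eqVlt => /orP[/eqP<- //|/H]; by rewrite ltxx.
Qed.

(** Unconditional convergence is absolute here: a finite sum outside [A] is a difference of two
    partial sums, hence small, and [sum_norm_le] passes to norms at the cost of a factor 4. *)
Lemma has_sum_abs_tail I (F : I -> R[i]) v : has_sum F v ->
  forall e : R, 0 < e -> exists A : {fset I}, forall B : {fset I},
    (A `<=` B)%fset -> `|\sum_(i <- B) F i - v| < e%:C /\
    \sum_(i <- B | i \notin A) `|F i| <= e%:C.
Proof.
move=> HF e e0; have e8 : 0 < e / 8%:R by rewrite divr_gt0.
have [A HA] := HF _ e8; exists A => B AB; split.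
  apply: lt_le_trans (HA _ AB) _; rewrite lecR ler_pdivrMr //.
  by rewrite ler_peMr ?ler1n // ltW.
rewrite -big_filter; have -> : e%:C = ((e / 8%:R)%:C *+ 2) *+ 4.
  rewrite -mulrnA -rmorphMn -[(2 * 4)%N]/8%N; apply: (congr1 (fun x => x%:C)).
  by rewrite -mulr_natr -mulrA mulVf ?mulr1 ?pnatr_eq0.
apply: sum_norm_le => P; rewrite big_filter_cond.
set M := [fset i in B | (i \in A) || P i]%fset.
have AM : (A `<=` M)%fset.
  by apply/fsubsetP => i iA; rewrite !inE /= (fsubsetP AB) // iA.
have -> : \sum_(i <- B | (i \notin A) && P i) F i =
    (\sum_(i <- M) F i - v) - (\sum_(i <- A) F i - v).
  rewrite opprB addrA subrK [X in _ = X - _](bigID (mem A)) /=.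
  rewrite (@big_uniq_cond _ _ M A _ predT) ?fset_uniq // => [|i].
    rewrite addrC addrK; apply: big_uniq_cond; rewrite ?fset_uniq // => i.
    by rewrite !inE /=; case: (i \in A); case: (i \in B); case: (P i).
  rewrite !inE /= andbT; case iA: (i \in A); rewrite ?andbF //.
  by rewrite (fsubsetP AB).
rewrite mulr2n; apply: le_trans (ler_normB _ _) _.
by rewrite lerD // ltW // HA // fsubset_refl.
Qed.

(* The family (i, j) |-> K i j, summed first over j and then over i.  It is
   summable over pairs because the inner sums involve no cancellation, so the
   order of summation can be exchanged.  D i and E j list, with the same
   multiplicities, the pairs that occur. *)
Lemma has_sum_exchange I J (D : I -> seq J) (E : J -> seq I)
    (K : I -> J -> R[i]) v :
  (forall i j, count_mem j (D i) = count_mem i (E j)) ->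
  (forall i, \sum_(j <- D i) `|K i j| <= `|\sum_(j <- D i) K i j|) ->
  has_sum (fun i => \sum_(j <- D i) K i j) v ->
  has_sum (fun j => \sum_(i <- E j) K i j) v.
Proof.
move=> DE nocancel HS e e0; have e2 : 0 < e / 2 by rewrite divr_gt0.
have [A HA] := has_sum_abs_tail HS e2.
(* With every [j] occurring in a row [D i], [i] in [A], these rows are summed in full over [B]. *)
exists [fset j in flatten [seq D i | i <- A]]%fset => B AB.
have DB i j : i \in A -> j \in D i -> j \in B.
  move=> iA jD; apply: (fsubsetP AB); rewrite inE /=.
  by apply/flattenP; exists (D i) => //; apply: map_f.
(* [M] also contains every row that meets [B], so the sum over [B] is a sum over [M] of rows
   truncated to [B]. *)
set M := (A `|` [fset i in flatten [seq E j | j <- B]])%fset.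
have AM : (A `<=` M)%fset by rewrite fsubsetUl.
have [HM1 HM2] := HA _ AM.
have -> : \sum_(j <- B) \sum_(i <- E j) K i j =
    \sum_(i <- M) \sum_(j <- D i | j \in B) K i j.
  transitivity (\sum_(j <- B) \sum_(i <- M) K i j *+ count_mem i (E j)).
    apply: eq_big_seq => j jB; apply: sumr_count_mem; first exact: fset_uniq.
    move=> i iE; rewrite !inE /=; apply/orP; right.
    by apply/flattenP; exists (E j) => //; apply: map_f.
  rewrite exchange_big /=; apply: eq_bigr => i _.
  rewrite -[RHS]big_filter.
  rewrite [RHS](@sumr_count_mem _ _ B) ?fset_uniq // => [|j].
    apply: eq_big_seq => j jB; rewrite -DE; congr (_ *+ _).
    rewrite count_filter; apply: eq_count => x /=.
    by case: eqP => //= ->.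
  by rewrite mem_filter => /andP[].
set S := (X in has_sum X _) in HS HA HM1 HM2.
(* Only rows outside [A] lose entries; [nocancel] bounds the loss by the absolute tail. *)
have -> : \sum_(i <- M) \sum_(j <- D i | j \in B) K i j - v =
   (\sum_(i <- M) S i - v) -
   \sum_(i <- M | i \notin A) \sum_(j <- D i | j \notin B) K i j.
  rewrite [RHS]addrAC; congr (_ - v); apply/eqP; rewrite eq_sym subr_eq.
  rewrite [X in _ == _ + X]big_mkcond -big_split /=; apply/eqP.
  apply: eq_bigr => i _; rewrite /S (bigID (mem B)) /=; congr (_ + _).
  case: ifPn => // /negPn iA; rewrite big_seq_cond big1 // => j /andP[jD].
  by rewrite (DB i).
rewrite [e]splitr rmorphD; apply: le_lt_trans (ler_normB _ _) _.
apply: ltr_leD HM1 _; apply: le_trans _ HM2.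
apply: le_trans (ler_norm_sum _ _ _) _; apply: ler_sum => i _.
apply: le_trans (ler_norm_sum _ _ _) _; apply: le_trans _ (nocancel i).
by rewrite [leRHS](bigID (mem B)) /= lerDr sumr_ge0.
Qed.

(** An exchange with lists of length at most one; the test [h (h' j) == j] recognises the image of
    [h]. *)
Lemma has_sum_inj I J (h : I -> J) (h' : J -> I) (F : I -> R[i]) v :
  cancel h h' -> has_sum F v ->
  has_sum (fun j => if h (h' j) == j then F (h' j) else 0) v.
Proof.
move=> hK HF.
have := @has_sum_exchange I J (fun i => [:: h i])
  (fun j => if h (h' j) == j then [:: h' j] else [::]) (fun i _ => F i) v.
move=> H; apply: has_sum_eq (H _ _ _) => [j|i j|i|].
- by case: ifP; rewrite ?big_seq1 ?big_nil.
- case: eqP => [E|nE] /=; first by rewrite -{1}E (can_eq hK) [i == _]eq_sym.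
  by case: eqP => //= E; case: nE; rewrite -E hK.
- by rewrite !big_seq1.
- by apply: has_sum_eq HF => i; rewrite big_seq1.
Qed.

End HasSum.

(** * Inserting and deleting a letter *)

Fixpoint insertions (b : bool) (w : word) : seq word :=
  if w is a :: w' then (b :: w) :: map (cons a) (insertions b w')
  else [:: [:: b]].

Fixpoint deletions (b : bool) (w : word) : seq word :=
  if w is a :: w' then
    (if a == b then [:: w'] else [::]) ++ map (cons a) (deletions b w')
  else [::].

Lemma count_mem_map_cons (a c : bool) (v : word) (s : seq word) :
  count_mem (c :: v) (map (cons a) s) = ((c == a) * count_mem v s)%N.
Proof.
elim: s => [|u s IH] /=; first by rewrite muln0.
by rewrite IH eqseq_cons [a == c]eq_sym; case: (c == a); rewrite ?mul1n ?mul0n.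
Qed.

(** Provides the multiplicity condition of [has_sum_exchange]; repetitions matter, since different
    positions may give the same word. *)
Lemma count_deletions b (w u : word) :
  count_mem u (deletions b w) = count_mem w (insertions b u).
Proof.
have map0 a s : count_mem ([::] : word) (map (cons a) s) = 0%N.
  by elim: s.
elim: w u => [|c w IH] [|a u] //=.
- by rewrite map0.
- rewrite count_cat map0 eqseq_cons [b == c]eq_sym; case: eqP => //= _.
  by rewrite [_ == w]eq_sym addn0.
- rewrite count_cat !count_mem_map_cons -IH eqseq_cons [b == c]eq_sym.
  rewrite [a == c]eq_sym; congr (_ + _)%N.
  by case: eqP => //= _; rewrite addn0 [_ == w]eq_sym.
Qed.

Lemma count_mem_deletion (a b : bool) (w u : word) :
  u \in deletions b w -> count_mem a w = ((b == a) + count_mem a u)%N.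
Proof.
elim: w u => [|c w IH] u //=; rewrite mem_cat => /orP[|/mapP[v /IH -> ->]] /=.
  by case: eqP => // ->; rewrite inE => /eqP ->.
by rewrite addnCA.
Qed.

(** * Reordering and derivations *)

Section Derivations.
Variable R : realType.
Implicit Types (F G : wseries R) (X L : qpseries R).

Definition qp_der (b : bool) X : qpseries R := fun s t =>
  if b == lp then t.+1%:R * X s t.+1 else s.+1%:R * X s.+1 t.

Definition lmul (a : bool) X := if a == lp then lmulp X else lmulq X.

(** Right multiplication by a letter, from q^s p^t q = q^(s+1) p^t - i t q^s p^(t-1). *)
Definition rmul (a : bool) X : qpseries R := fun s t =>
  if a == lp then (if t is t'.+1 then X s t' else 0)
  else (if s is s'.+1 then X s' t else 0) - 'i%R * t.+1%:R * X s t.+1.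

Definition qp_ad (a : bool) X : qpseries R := fun s t =>
  (if a == lp then - 'i%R else 'i%R) * qp_der (~~ a) X s t.

Lemma lmul_rmulC a b X : lmul a (rmul b X) = rmul b (lmul a X).
Proof.
apply/funext => s; apply/funext => t; rewrite /lmul /rmul /lmulp /lmulq.
by case: a; case: b => /=; case: s => [|s]; case: t => [|t] //=; ring.
Qed.

Lemma lmul_sub_rmul a X s t : lmul a X s t - rmul a X s t = qp_ad a X s t.
Proof.
by case: a; rewrite /lmul /rmul /lmulp /lmulq /qp_ad /qp_der /=; ring.
Qed.

(** Partial derivatives commute; for commutators this is the Jacobi identity, as [q, p] is
    central. *)
Lemma qp_adC a b X : qp_ad a (qp_ad b X) = qp_ad b (qp_ad a X).
Proof.
by apply/funext => s; apply/funext => t; case: a; case: b;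
  rewrite /qp_ad /qp_der //=; ring.
Qed.

Lemma reorder_cons a w : reorder R (a :: w) = lmul a (reorder R w).
Proof. by []. Qed.

Lemma reorder_rcons w a : reorder R (rcons w a) = rmul a (reorder R w).
Proof.
elim: w => [|c w IH]; last by rewrite rcons_cons !reorder_cons IH lmul_rmulC.
apply/funext => s; apply/funext => t.
rewrite /= /lmulp /lmulq /rmul /qp_one; case: a => /=;
  case: s => [|[|s]]; case: t => [|[|t]] //=; ring.
Qed.

Lemma lmul_sum a (r : seq word) s t :
  \sum_(u <- r) lmul a (reorder R u) s t =
  lmul a (fun s t => \sum_(u <- r) reorder R u s t) s t.
Proof.
rewrite /lmul; case: a => /=; last by case: s => [|s] //=; rewrite big1.
rewrite /lmulp sumrB -mulr_sumr; case: t => [|t] //=; by rewrite big1.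
Qed.

Lemma sum_reorder_deletions b w s t :
  \sum_(u <- deletions b w) reorder R u s t = qp_der b (reorder R w) s t.
Proof.
elim: w s t => [|a w IH] s t.
  by rewrite big_nil /qp_der /= /qp_one; case: b; rewrite /= ?andbF mulr0.
rewrite reorder_cons /= big_cat big_map /= lmul_sum.
have -> : (fun s t => \sum_(u <- deletions b w) reorder R u s t) =
    qp_der b (reorder R w).
  by apply/funext => s'; apply/funext => t'; exact: IH.
case: a; case: b {IH}; rewrite /= ?big_nil ?big_seq1;
  move: (reorder R w) => X;
  rewrite /qp_der /lmul /= /lmulp /lmulq;
  case: s => [|s]; case: t => [|t] /=; ring.
Qed.

(* All contributions to the coefficient of q^s p^t in the reordering of a word
   come from contracting the same number of pairs, hence have the same phase. *)
Lemma reorder_phase w s t : exists n : nat,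
  reorder R w s t = (- 'i%R) ^+ count_mem lq w * 'i%R ^+ s * n%:R.
Proof.
elim: w s t => [|a w IH] s t.
  exists ((s == 0) && (t == 0))%N; rewrite /= /qp_one.
  by case: s => [|s]; rewrite ?mul1r ?mul1r // mulr0.
have i2 : 'i%R * 'i%R = -1 :> R[i] by rewrite -expr2 sqrCi.
rewrite reorder_cons /lmul; case: a => /=.
  (* The contraction term brings a factor -i and trades ['i ^+ s.+1] for ['i ^+ s]; since -i * i =
     1, the phase is kept. *)
  rewrite /lmulp add0n; have [n ->] := IH s.+1 t.
  have -> : - ('i%R * s.+1%:R * ((- 'i%R) ^+ count_mem lq w * 'i%R ^+ s.+1
     * n%:R)) = (- 'i%R) ^+ count_mem lq w * 'i%R ^+ s * (s.+1 * n)%:R :> R[i].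
    rewrite natrM exprS.
    transitivity (- ('i%R * 'i%R) * ((- 'i%R) ^+ count_mem lq w * 'i%R ^+ s
      * (s.+1%:R * n%:R)) : R[i]); first by ring.
    by rewrite i2 opprK mul1r.
  case: t => [|t]; first by exists (s.+1 * n)%N; rewrite add0r.
  have [m ->] := IH s t; exists (m + s.+1 * n)%N.
  by rewrite natrD mulrDr.
case: s => [|s] /=; first by exists 0%N; rewrite mulr0.
have [n ->] := IH s t; exists n; rewrite add1n !exprS.
transitivity (- ('i%R * 'i%R) * ((- 'i%R) ^+ count_mem lq w * 'i%R ^+ s
      * n%:R) : R[i]); last by ring.
by rewrite i2 opprK mul1r.
Qed.

(** All deletions of [b] from [w] contain equally many letters q, so by [reorder_phase] their
    contributions share one phase. *)
Lemma sum_norm_reorder_deletions b w s t :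
  \sum_(u <- deletions b w) `|reorder R u s t| <=
  `|\sum_(u <- deletions b w) reorder R u s t|.
Proof.
set c : R[i] := (- 'i%R) ^+ (count_mem lq w - (b == lq)) * 'i%R ^+ s.
have c1 : `|c| = 1 by rewrite normrM !normrX normrN normCi !expr1n mulr1.
have H u : u \in deletions b w -> reorder R u s t = c * `|reorder R u s t|.
  move=> /(count_mem_deletion lq) E; have [n ->] := reorder_phase u s t.
  rewrite /c E addKn; move: c1; rewrite /c E addKn => c1.
  by rewrite normrM c1 mul1r normr_nat.
rewrite [X in _ <= `|X|](eq_big_seq _ H) -mulr_sumr normrM c1 mul1r.
exact: real_ler_norm (ger0_real (sumr_ge0 _ _)).
Qed.

(** The transpose of deletion: [w] receives the coefficients of all words from which deleting one
    [b] leaves [w]. *)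
Definition wder (b : bool) F : wseries R := fun w =>
  \sum_(u <- insertions b w) F u.

(** The terms [F w * reorder R u s t], with [u] a deletion of [w], give the derivative of [X] when
    grouped by [w] and the reordering of [wder b F] when grouped by [u]. *)
Lemma denotes_wder b F X : denotes F X -> denotes (wder b F) (qp_der b X).
Proof.
move=> FX s t.
have H : has_sum (fun w => F w * qp_der b (reorder R w) s t) (qp_der b X s t).
  rewrite /qp_der; case: b => /=.
    apply: has_sum_eq (has_sumZ t.+1%:R (FX s t.+1)) => w; ring.
  apply: has_sum_eq (has_sumZ s.+1%:R (FX s.+1 t)) => w; ring.
have := @has_sum_exchange _ _ _ (deletions b) (insertions b)
  (fun w u => F w * reorder R u s t) (qp_der b X s t).
move=> K; apply: has_sum_eq (K _ _ _) => [u|w u|w|].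
- by rewrite mulr_suml.
- exact: count_deletions.
- rewrite -mulr_sumr normrM.
  rewrite (eq_bigr (fun u => `|F w| * `|reorder R u s t|)) => [|u _].
    by rewrite -mulr_sumr ler_wpM2l // sum_norm_reorder_deletions.
  by rewrite normrM.
- by apply: has_sum_eq H => w; rewrite -mulr_sumr sum_reorder_deletions.
Qed.

Lemma wmul_nil F G : wmul F G [::] = F [::] * G [::].
Proof. by rewrite /wmul big_ord1. Qed.

Lemma wmul_cons F G a w :
  wmul F G (a :: w) = F [::] * G (a :: w) + wmul (fun v => F (a :: v)) G w.
Proof. by rewrite /wmul big_ord_recl /=. Qed.

Lemma wmul_letterl a F w :
  wmul (letter R a) F w = if a :: behead w == w then F (behead w) else 0.
Proof.
case: w => [|c w]; first by rewrite wmul_nil /letter mul0r.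
rewrite wmul_cons /letter mul0r add0r eqseq_cons eqxx andbT /=.
rewrite /wmul big_ord_recl take0 drop0 big1 => [|j _].
  rewrite eqseq_cons eqxx andbT addr0 eq_sym.
  by case: eqP; rewrite ?mul1r ?mul0r.
by case: w j => [|d w] [j lj] //=; rewrite eqseq_cons /= andbF mul0r.
Qed.

Lemma wmul_letterr_rcons a F w c :
  wmul F (letter R a) (rcons w c) = (c == a)%:R * F w.
Proof.
rewrite /wmul size_rcons big_ord_recr /= big_ord_recr /= big1 => [|j _].
  rewrite -[rcons w c]cats1 take_size_cat // drop_size_cat //.
  rewrite drop_oversize ?size_cat ?addn1 // /letter !eqseq_cons eqxx andbT.
  by rewrite mulr0 addr0 add0r mulrC.
rewrite drop_rcons; last exact: ltnW.
rewrite (drop_nth a) // /letter.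
by case: (drop _ _) => [|d r]; rewrite eqseq_cons andbF mulr0.
Qed.

Lemma denotes_wmul_letterl a F X :
  denotes F X -> denotes (wmul (letter R a) F) (lmul a X).
Proof.
move=> FX s t.
have H : has_sum (fun w => F w * reorder R (a :: w) s t) (lmul a X s t).
  rewrite /lmul; case: a => /=; last first.
    case: s => [|s] /=; last exact: FX.
    by apply: has_sum_eq (has_sum0 _) => w; rewrite mulr0.
  rewrite /lmulp.
  have H1 := has_sumZ ('i%R * s.+1%:R) (FX s.+1 t).
  case: t H1 => [|t] H1.
    by apply: has_sum_eq (has_sumB (has_sum0 _) H1) => w; ring.
  by apply: has_sum_eq (has_sumB (FX s t) H1) => w; ring.
apply: has_sum_eq (has_sum_inj (h := cons a) (h' := behead) _ H) => // w.
by rewrite wmul_letterl; case: eqP => [->|_] //; rewrite mul0r.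
Qed.

Lemma denotes_wmul_letterr a F X :
  denotes F X -> denotes (wmul F (letter R a)) (rmul a X).
Proof.
move=> FX s t.
have H : has_sum (fun w => F w * reorder R (rcons w a) s t) (rmul a X s t).
  have E w : F w * reorder R (rcons w a) s t = F w * rmul a (reorder R w) s t.
    by rewrite reorder_rcons.
  apply: has_sum_eq (fun w => esym (E w)) _.
  rewrite /rmul; case: a {E} => /=.
    case: t => [|t] /=; last exact: FX.
    by apply: has_sum_eq (has_sum0 _) => w; rewrite mulr0.
  have H1 := has_sumZ ('i%R * t.+1%:R) (FX s t.+1).
  case: s H1 => [|s] H1.
    by apply: has_sum_eq (has_sumB (has_sum0 _) H1) => w; ring.
  by apply: has_sum_eq (has_sumB (FX s t) H1) => w; ring.
(* [h'] drops the last letter; it fixes the empty word, which the test in [has_sum_inj] then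
   rejects. *)
pose h' (w : word) := take (size w).-1 w.
have h'K c : cancel (rcons^~ c) h'.
  by move=> w; rewrite /h' size_rcons /= -cats1 take_size_cat.
apply: has_sum_eq (has_sum_inj (h'K a) H) => w.
case/lastP: w => [|w c]; first by rewrite wmul_nil /letter mulr0 mul0r.
rewrite h'K wmul_letterr_rcons eqseq_rcons eqxx /= [a == c]eq_sym.
by case: eqP => [->|_]; rewrite ?mul1r // !mul0r.
Qed.

Lemma denotes_eq F G X : F =1 G -> denotes F X -> denotes G X.
Proof. by move=> /funext ->. Qed.

Lemma denotes_unique F X Y : denotes F X -> denotes F Y -> X = Y.
Proof.
move=> FX FY; apply/funext => s; apply/funext => t.
exact: has_sum_unique (FX s t) (FY s t).
Qed.

Lemma denotes0 F : F =1 (fun=> 0) -> denotes F (qp_zero R).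
Proof.
by move=> F0 s t; apply: has_sum_eq (has_sum0 _) => w; rewrite F0 mul0r.
Qed.

Lemma denotes_wadd F G X Y : denotes F X -> denotes G Y ->
  denotes (wadd F G) (fun s t => X s t + Y s t).
Proof.
move=> FX GY s t; apply: has_sum_eq (has_sumD (FX s t) (GY s t)) => w.
by rewrite -mulrDl.
Qed.

Lemma denotes_wsub F G X Y : denotes F X -> denotes G Y ->
  denotes (wsub F G) (fun s t => X s t - Y s t).
Proof.
move=> FX GY s t; apply: has_sum_eq (has_sumB (FX s t) (GY s t)) => w.
by rewrite -mulrBl.
Qed.

Lemma denotes_wscale c F X :
  denotes F X -> denotes (wscale c F) (fun s t => c * X s t).
Proof.
move=> FX s t; apply: has_sum_eq (has_sumZ c (FX s t)) => w.
by rewrite mulrA.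
Qed.

Lemma denotes_wcomm a F X :
  denotes F X -> denotes (wcomm (letter R a) F) (qp_ad a X).
Proof.
move=> FX s t; rewrite -lmul_sub_rmul.
exact: denotes_wsub (denotes_wmul_letterl a FX) (denotes_wmul_letterr a FX) s t.
Qed.

(** Stands in for the commutator with a letter: already before reordering it maps embeddings to
    embeddings and letters to scalars. *)
Definition wad (a : bool) F : wseries R :=
  wscale (if a == lp then - 'i%R else 'i%R) (wder (~~ a) F).

Lemma denotes_wad a F X : denotes F X -> denotes (wad a F) (qp_ad a X).
Proof. by move=> FX; exact/denotes_wscale/denotes_wder. Qed.

End Derivations.

(** * The algebra of word series *)

Section WordAlgebra.
Variable R : realType.
Implicit Types (F G : wseries R) (X L : qpseries R).

Lemma wder_cons b F a w :
  wder b F (a :: w) = F (b :: a :: w) + wder b (fun v => F (a :: v)) w.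
Proof. by rewrite /wder /= big_cons big_map. Qed.

Lemma wmulDl F G K : wmul (wadd F G) K = wadd (wmul F K) (wmul G K).
Proof.
apply/funext => w; rewrite /wadd /wmul -big_split.
by apply: eq_bigr => j _; rewrite mulrDl.
Qed.

Lemma wmulZl c F G : wmul (wscale c F) G = wscale c (wmul F G).
Proof.
apply/funext => w; rewrite /wscale /wmul mulr_sumr.
by apply: eq_bigr => j _; rewrite mulrA.
Qed.

Lemma wmulZr c F G : wmul F (wscale c G) = wscale c (wmul F G).
Proof.
apply/funext => w; rewrite /wscale /wmul mulr_sumr.
by apply: eq_bigr => j _; rewrite mulrCA.
Qed.

Definition wone : wseries R := fun w => (w == [::])%:R.

Lemma wmul1l F : wmul wone F = F.
Proof.
apply/funext => -[|a w]; first by rewrite wmul_nil mul1r.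
by rewrite wmul_cons mul1r /wmul big1 ?addr0 // => j _; rewrite mul0r.
Qed.

Lemma wmul1r F : wmul F wone = F.
Proof.
apply/funext => w; rewrite /wmul big_ord_recr /= take_size drop_size mulr1.
rewrite big1 ?add0r // => j _; rewrite /wone (drop_nth lq) //=.
by rewrite mulr0.
Qed.

(** The induction generalises [F], because stripping the first letter of the word replaces [F] by
    [fun v => F (a :: v)]. *)
Lemma wder_wmul b F G :
  wder b (wmul F G) = wadd (wmul (wder b F) G) (wmul F (wder b G)).
Proof.
apply/funext => w; rewrite /wadd; elim: w F => [|a w IH] F.
  by rewrite !wmul_nil /wder /= !big_seq1 wmul_cons wmul_nil addrC.
rewrite wder_cons !wmul_cons.
have -> : (fun v => wmul F G (a :: v)) =
    wadd (wscale (F [::]) (fun v => G (a :: v))) (wmul (fun v => F (a :: v)) G).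
  by apply/funext => v; rewrite wmul_cons.
have -> : wder b (wadd (wscale (F [::]) (fun v => G (a :: v)))
    (wmul (fun v => F (a :: v)) G)) w =
    F [::] * wder b (fun v => G (a :: v)) w +
    wder b (wmul (fun v => F (a :: v)) G) w.
  by rewrite /wder big_split mulr_sumr.
have -> : (fun v => wder b F (a :: v)) =
    wadd (fun v => F (b :: a :: v)) (wder b (fun v => F (a :: v))).
  by apply/funext => v; rewrite wder_cons.
rewrite IH wmulDl /wadd wder_cons /wder /= big_seq1; ring.
Qed.

Lemma wder_rcons b F w a : wder b F (rcons w a) =
  F (rcons (rcons w a) b) + wder b (fun v => F (rcons v a)) w.
Proof.
elim: w F => [|c w IH] F; first by rewrite /wder !big_cons !big_nil !addr0 addrC.
by rewrite rcons_cons !wder_cons IH addrCA.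
Qed.

Lemma wder_rev b F w : wder b (fun u => F (rev u)) w = wder b F (rev w).
Proof.
elim: w F => [|a w IH] F; first by rewrite /wder /= !big_seq1.
rewrite wder_cons [rev (a :: w)]rev_cons wder_rcons !rev_cons; congr (_ + _).
rewrite -IH; apply: eq_bigr => u _; by rewrite rev_cons.
Qed.

Lemma wder_wadj b F : wder b (wadj F) = wadj (wder b F).
Proof.
by apply/funext => w; rewrite /wadj -wder_rev /wder rmorph_sum.
Qed.

Lemma wadjK F : wadj (wadj F) = F.
Proof. by apply/funext => w; rewrite /wadj revK conjcK. Qed.

Lemma wadj_wmul F G : wadj (wmul F G) = wmul (wadj G) (wadj F).
Proof.
apply/funext => w; rewrite /wadj /wmul rmorph_sum (reindex_inj rev_ord_inj).
rewrite size_rev; apply: eq_bigr => j _ /=.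
have jw : (j <= size w)%N by rewrite -ltnS.
by rewrite subSS rmorphM mulrC take_rev drop_rev subKn.
Qed.

Lemma wder_letter b a : wder b (letter R a) = wscale (a == b)%:R wone.
Proof.
apply/funext => w; transitivity ((count_mem [:: a] (insertions b w))%:R : R[i]).
  rewrite /wder; elim: (insertions b w) => [|u r IH]; first by rewrite big_nil.
  by rewrite big_cons IH /= natrD.
rewrite -count_deletions /= /wscale /wone; case: eqP => _ /=.
  by rewrite mul1r addn0 eq_sym.
by rewrite mul0r.
Qed.

(** The quotient by a leading letter. An ordered word starting with p contains no q, hence the test
    [k == 0]. *)
Definition qp_tail (a : bool) X : qpseries R := fun k l =>
  if a == lp then (if k == 0 then X 0 l.+1 else 0) else X k.+1 l.

Lemma embed_cons X a w : embed X (a :: w) = embed (qp_tail a X) w.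
Proof.
rewrite /embed /qp_tail; case: a => /=; last by rewrite add0n eqseq_cons.
rewrite add0n add1n; case: (count_mem lq w) => [|k] /=.
  by rewrite eqseq_cons.
by case: ifP.
Qed.

(** Deleting a letter keeps an ordered word ordered, and the k letters q of q^k p^l all give the
    same word, likewise for p; this is the factor in [qp_der]. *)
Lemma wder_embed b X : wder b (embed X) = embed (qp_der b X).
Proof.
apply/funext => w; elim: w X => [|a w IH] X.
  by rewrite /wder /= big_seq1 /embed /qp_der; case: b; rewrite /= mul1r.
rewrite wder_cons.
have -> : (fun v => embed X (a :: v)) = embed (qp_tail a X).
  by apply/funext => v; exact: embed_cons.
rewrite IH !embed_cons /embed; case: ifP => _; rewrite ?addr0 //.
rewrite /qp_tail /qp_der; case: a; case: b {IH} => /=;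
  case: (count_mem _ _) => [|k] /=; ring.
Qed.

Lemma embedZ c X : embed (fun s t => c * X s t) = wscale c (embed X).
Proof.
by apply/funext => w; rewrite /wscale /embed; case: ifP; rewrite ?mulr0.
Qed.

Lemma reorder_monomial k l s t :
  reorder R (nseq k lq ++ nseq l lp) s t = ((s == k) && (t == l))%:R.
Proof.
elim: k s t => [|k IH] s t; last by case: s => [|s] //=; rewrite eqSS -IH.
elim: l s t => [|l IH] s t //=; rewrite /lmulp (IH s.+1) mulr0 subr0.
by case: t => [|t]; rewrite ?andbF // (IH s).
Qed.

Lemma denotes_embed X : denotes (embed X) X.
Proof.
move=> s t; pose w0 := nseq s lq ++ nseq t lp.
have cq k l : count_mem lq (nseq k lq ++ nseq l lp) = k.
  by rewrite count_cat !count_nseq mul1n mul0n addn0.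
have cp k l : count_mem lp (nseq k lq ++ nseq l lp) = l.
  by rewrite count_cat !count_nseq mul1n mul0n.
have E : embed X w0 * reorder R w0 s t = X s t.
  by rewrite /embed /w0 cq cp eqxx reorder_monomial !eqxx mulr1.
rewrite -E; apply: has_sum_single => w ww0; rewrite /embed.
case: eqP => [E'|_]; last by rewrite mul0r.
rewrite {3}E' reorder_monomial; case: eqP => [es|]; rewrite ?mulr0 //=.
case: eqP => [et|]; rewrite ?mulr0 //.
by case/eqP: ww0; rewrite E' -es -et.
Qed.

Lemma wadD a F G : wad a (wadd F G) = wadd (wad a F) (wad a G).
Proof.
by apply/funext => w; rewrite /wad /wscale /wder /wadd big_split mulrDr.
Qed.

Lemma wadZ a c F : wad a (wscale c F) = wscale c (wad a F).
Proof. by apply/funext => w; rewrite /wad /wscale /wder -mulr_sumr mulrCA. Qed.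

Lemma wad_wmul a F G :
  wad a (wmul F G) = wadd (wmul (wad a F) G) (wmul F (wad a G)).
Proof.
rewrite /wad wder_wmul wmulZl wmulZr.
by apply/funext => w; rewrite /wscale /wadd mulrDr.
Qed.

Lemma wad_embed a X : wad a (embed X) = embed (qp_ad a X).
Proof. by rewrite /wad wder_embed -embedZ. Qed.

(** Conjugation flips the sign of the imaginary factor in [wad], while [wder] commutes with the
    adjoint. *)
Lemma wad_wadj a F : wad a (wadj F) = wscale (-1) (wadj (wad a F)).
Proof.
rewrite /wad wder_wadj; apply/funext => w.
rewrite /wscale /wadj; set c := (X in X * _).
have cJ : conjc c = - c.
  rewrite /c; case: (a == lp); last exact: conjCi.
  by rewrite rmorphN; congr (- _); exact: conjCi.
by rewrite rmorphM [X in _ = _ * (X * _)]cJ mulN1r mulNr opprK.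
Qed.

(** [wad a (letter R b)] is a scalar, so the two extra Leibniz terms cancel. *)
Lemma wad_wcomm_letter a b F :
  wad a (wcomm (letter R b) F) = wcomm (letter R b) (wad a F).
Proof.
have -> : wcomm (letter R b) F =
    wadd (wmul (letter R b) F) (wscale (-1) (wmul F (letter R b))).
  by apply/funext => w; rewrite /wadd /wscale mulN1r.
rewrite wadD wadZ !wad_wmul /wad wder_letter; apply/funext => w.
rewrite !(wmulZl, wmulZr) wmul1l wmul1r /wcomm /wsub /wadd !(wmulZl, wmulZr).
rewrite /wscale; ring.
Qed.

End WordAlgebra.

(** * Ito differentials of commutators *)

Section Preservation.
Variable R : realType.
Implicit Types (F G : wseries R) (X : qpseries R).

Lemma denotes_wcomm_sub_wad a F G X : denotes F X -> denotes G X ->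
  denotes (wsub (wcomm (letter R a) F) (wad a G)) (qp_zero R).
Proof.
move=> FX GX s t.
have := denotes_wsub (denotes_wcomm a FX) (denotes_wad a GX) s t.
by rewrite subrr.
Qed.

Lemma xvecE (i : 'I_2) : xvec R i 0 = letter R (i != ord0).
Proof. by rewrite mxE; case: (i == ord0). Qed.

(* The representatives Fi and Fj of the increments dX c and dY c can be chosen
   freely, so it suffices to find some for which the derivations wad cancel
   against the Ito correction before any reordering. *)
Lemma denotes_d_comm (a b : bool) (dX dY : differential R) (c : increment)
    (Fi Fj : wseries R) (Xi Xj : qpseries R) :
  denotes (dX c) Xi -> denotes Fi Xi -> denotes (dY c) Xj -> denotes Fj Xj ->
  denotes (wadd (wsub (wad a Fj) (wad b Fi))
                (wsub (ito_product dX dY c) (ito_product dY dX c)))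
          (qp_zero R) ->
  denotes (d_comm (letter R a) dX (letter R b) dY c) (qp_zero R).
Proof.
move=> dXi FXi dYj FYj FE s t.
have Hj := denotes_wcomm_sub_wad a dYj FYj.
have Hi := denotes_wcomm_sub_wad b dXi FXi.
have := denotes_wadd (denotes_wsub Hj Hi) FE s t.
rewrite subrr addr0; apply: has_sum_eq => w; congr (_ * _).
rewrite /d_comm /d_mul /wcomm /wsub /wadd; ring.
Qed.

End Preservation.

Theorem proposition28 (R : realType) (f g : 'cV[qpseries R]_2)
    (gstar_well_defined : forall i, well_defined (wadj (embed (g i 0)))) :
  physically_realizable f g -> preserves_commutation_relations f g.
Proof.
case=> H [L [_ _ fW gW]] i j c.
have gE k : g k 0 = qp_ad (k != ord0) L.
  apply: denotes_unique (gW k) _; rewrite xvecE.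
  exact/denotes_wcomm/denotes_embed.
rewrite !xvecE; set a := i != ord0; set b := j != ord0.
have dcomm := @denotes_d_comm R a b (dxvec f g i) (dxvec f g j).
case: c.
(* The literal coefficient [embed (f i 0)] is traded for its expression in [H] and [L]. *)
- apply: (dcomm dt _ _ _ _ (denotes_embed _) (fW i) (denotes_embed _) (fW j)).
  rewrite /gstarL !xvecE !gE -/a -/b !wadj_wmul !wadjK.
  rewrite !(wadD, wadZ, wad_wcomm_letter, wad_wmul, wad_wadj, wad_embed).
  rewrite (qp_adC b a) /= !gE -/a -/b.
  (* The Hamiltonian part stays a difference of commutators, which vanishes after reordering by
     [qp_adC]. *)
  have HH := denotes_wscale (- 'i%R) (denotes_wsub
    (denotes_wcomm b (denotes_embed (qp_ad a H)))
    (denotes_wcomm a (denotes_embed (qp_ad b H)))).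
  have {}HH : denotes (wscale (- 'i%R) (wsub
      (wcomm (letter R b) (embed (qp_ad a H)))
      (wcomm (letter R a) (embed (qp_ad b H))))) (qp_zero R).
    by move=> s t; have := HH s t; rewrite (qp_adC b a) subrr mulr0.
  (* Terms still containing [L] cancel because [x_i, g_j] = [x_j, g_i]; the remaining halves add up
     to g_j^* g_i - g_i^* g_j, opposite to the Ito correction. *)
  apply: denotes_eq HH => w; rewrite !(wmulZl, wmulZr) /wadd /wsub /wscale.
  by field.
(* Each dA coefficient is its own representative, and [gstar_well_defined] supplies the element it
   denotes. *)
- have [[Gi HGi] [Gj HGj]] := (gstar_well_defined i, gstar_well_defined j).
  apply: (dcomm dA _ _ _ _ HGi HGi HGj HGj); rewrite !gE -/a -/b.
  rewrite !(wad_wadj, wad_embed) (qp_adC b a); apply: denotes0 => w.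
  by rewrite /wadd /wsub /= /wzero !subrr addr0.
- apply: (dcomm dAs _ _ _ _ (denotes_embed _) (denotes_embed _)
    (denotes_embed _) (denotes_embed _)); rewrite !gE -/a -/b.
  rewrite !wad_embed (qp_adC b a); apply: denotes0 => w.
  by rewrite /wadd /wsub /= /wzero !subrr addr0.
Qed.
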